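(* Let $\mathfrak g$ be a semisimple Lie algebra of matrices, the Lie algebra of a Lie group $G$ acting on $M=S^1$ (with coordinate $s$). Then the map $$\beta:C^\infty(S^1,\mathfrak g)\times C^\infty(S^1,\mathfrak g)\to\mathbb R,\qquad\beta(x,y)=\int_{S^1}\mathrm{tr}(x\,y_s)\,ds,$$ which is a cocycle for the pointwise bracket, is also a cocycle when $C^\infty(S^1,\mathfrak g)$ is endowed with the second bracket $\llbracket\,\cdot\,,\,\cdot\,\rrbracket$.
   Context: Here $y_s$ is the derivative with respect to $s$. A cocycle on a Lie algebra with bracket $[\,,]$ is a skew-symmetric bilinear map $\beta$ to $\mathbb R$ satisfying $\beta(w_1,[w_2,w_3])+\beta(w_2,[w_3,w_1])+\beta(w_3,[w_1,w_2])=0$ for all $w_1,w_2,w_3$. Second bracket. Let $v_1,\dots,v_r$ be a basis of $\mathfrak g$ and $X_j(s)=\frac{d}{dt}|_{t=0}\exp(tv_j)\cdot s$ the infinitesimal vector fields of the action on $M$. For $x=\sum_jx^jv_j$ and $y=\sum_jy^jv_j$ in $C^\infty(M,\mathfrak g)$, let $\rho(x)=\sum_jx^jX_j$ (a vector field on $M$), let $\mathcal L_{\rho(x)}y=\sum_j\rho(x)(y^j)v_j$, and let $[x,y](s)=[x(s),y(s)]$ be the pointwise bracket (matrix commutator). Then $\llbracket x,y\rrbracket=\mathcal L_{\rho(x)}y-\mathcal L_{\rho(y)}x-[x,y]$ if the action is a left action ($h\cdot(g\cdot s)=(hg)\cdot s$), and $\llbracket x,y\rrbracket=-\mathcal L_{\rho(x)}y+\mathcal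 L_{\rho(y)}x-[x,y]$ if it is a right action ($h\cdot(g\cdot s)=(gh)\cdot s$). This $\llbracket\,,\rrbracket$ is a Lie bracket on $C^\infty(M,\mathfrak g)$. *)

(* Defs.v *)
From HB Require Import structures.
From mathcomp Require Import all_boot all_order all_algebra.
From mathcomp Require Import all_classical all_reals all_analysis.

Set Implicit Arguments.
Unset Strict Implicit.
Unset Printing Implicit Defensive.

Import Order.TTheory GRing.Theory Num.Theory.
Import numFieldNormedType.Exports.

Local Open Scope classical_set_scope.
Local Open Scope ring_scope.

Section LieAlgebra.
Context {F : fieldType} {n : nat}.
Implicit Types U I g : {vspace 'M[F]_n}.

Definition lie (A B : 'M[F]_n) : 'M[F]_n := A *m B - B *m A.

Definition lie_algebra g : Prop :=
  forall A B, A \in g -> B \in g -> lie A B \in g.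

(* By bilinearity, the brackets of two bases span all of [U, V]. *)
Definition lie_span U V : {vspace 'M[F]_n} :=
  <<[seq lie a b | a <- vbasis U, b <- vbasis V]>>%VS.

Definition lie_ideal g I : Prop := (I <= g)%VS /\ (lie_span g I <= I)%VS.

Definition lie_solvable U : Prop :=
  exists k, iter k (fun W => lie_span W W) U = 0%VS.

Definition semisimple g : Prop :=
  lie_algebra g /\ forall I, lie_ideal g I -> lie_solvable I -> I = 0%VS.

End LieAlgebra.

Section Smooth.
Context {R : realType}.

(* Meant for open U and finite-dimensional V. *)
Fixpoint Ck {V W : normedModType R} (k : nat) (U : set V) (f : V -> W) : Prop :=
  match k with
  | 0 => forall x, U x -> {for x, continuous f}
  | k'.+1 => (forall x, U x -> differentiable f x) /\
             (forall v : V, Ck k' U (fun x => 'D_v f x))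
  end.

Definition smooth {V W : normedModType R} (U : set V) (f : V -> W) : Prop :=
  forall k, Ck k U f.

End Smooth.

#[short(type="topGroupType")]
HB.structure Definition TopGroup := {G of Group G & Topological G}.

(* A chart of dimension d: only the values of coo on dom, and those of param on
   coo @` dom, are meaningful. *)
Record chart (R : realType) (T : Type) (d : nat) := Chart {
  dom : set T;
  coo : T -> 'rV[R]_d;
  param : 'rV[R]_d -> T }.

Section LieGroup.
Context {R : realType} {d : nat}.

Definition cdom {T : Type} (c : chart R T d) : set 'rV[R]_d := coo c @` dom c.

Definition is_chart {T : topologicalType} (c : chart R T d) : Prop :=
  [/\ open (dom c), open (cdom c),
      forall x, dom c x -> param c (coo c x) = x,
      forall x, dom c x -> {for x, continuous (coo c)} &
      forall u, cdom c u -> {for u, continuous (param c)}].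

Definition is_atlas {T : topologicalType} (A : set (chart R T d)) : Prop :=
  [/\ forall c, A c -> is_chart c,
      forall x, exists2 c, A c & dom c x &
      forall c1 c2, A c1 -> A c2 ->
        smooth (coo c1 @` (dom c1 `&` dom c2)) (coo c2 \o param c1)].

(* Smoothness of a map from an open set U of a normed space to a manifold. *)
Definition smooth_into {T : topologicalType} (A : set (chart R T d))
    {V : normedModType R} (U : set V) (f : V -> T) : Prop :=
  (forall u, U u -> {for u, continuous f}) /\
  (forall c, A c -> smooth (U `&` f @^-1` dom c) (coo c \o f)).

Definition is_lie_group (G : topGroupType) (A : set (chart R G d)) : Prop :=
  [/\ hausdorff_space G /\ second_countable (T := G),
      is_atlas A,
      forall c1 c2, A c1 -> A c2 ->
        smooth_into A (cdom c1 `*` cdom c2)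
          (fun p => (param c1 p.1 * param c2 p.2)%g) &
      forall c, A c -> smooth_into A (cdom c) (fun u => (param c u)^-1%g)].

(* The left-invariant vector field with value v at 1, read in a chart c
   around 1. *)
Definition linv_field {G : topGroupType} (c : chart R G d) (v : 'rV[R]_d) :
    'rV[R]_d -> 'rV[R]_d :=
  fun u => 'D_v (fun w : 'rV[R]_d => coo c (param c u * param c w)%g)
             (coo c 1%g).

(* The bracket of T_1 G, which is identified with 'rV[R]_d by the chart c: the
   value at 1 of the Lie bracket of left-invariant vector fields. *)
Definition tangent_bracket {G : topGroupType} (c : chart R G d)
    (v w : 'rV[R]_d) : 'rV[R]_d :=
  'D_v (linv_field c w) (coo c 1%g) - 'D_w (linv_field c v) (coo c 1%g).

(* The matrix Lie algebra g is the Lie algebra of G: theta restricts to a Lie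
   algebra isomorphism from g to T_1 G (its values outside g are irrelevant),
   and expG is the exponential map of G, i.e. t |-> expG (t X) is the
   one-parameter subgroup of G with velocity theta X at 1. *)
Definition is_lie_algebra_of {G : topGroupType} (A : set (chart R G d))
    (c : chart R G d) {n : nat} (g : {vspace 'M[R]_n})
    (theta : {linear 'M[R]_n -> 'rV[R]_d}) (expG : 'M[R]_n -> G) : Prop :=
  [/\ set_bij [set` g] [set: 'rV[R]_d] theta,
      forall X Y, X \in g -> Y \in g ->
        theta (lie X Y) = tangent_bracket c (theta X) (theta Y) &
      forall X, X \in g ->
        [/\ forall s t : R, expG ((s + t) *: X)
                            = (expG (s *: X) * expG (t *: X))%g,
            smooth_into A [set: R] (fun t : R => expG (t *: X)) &
            derive1 (fun t : R => coo c (expG (t *: X))) 0 = theta X]].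

End LieGroup.

Variant action_side := LeftAction | RightAction.

Section Circle.
Context {R : realType}.

Definition circle : set (R * R) := [set p | p.1 ^+ 2 + p.2 ^+ 2 = 1].

Definition circ (s : R) : R * R := (cos s, sin s).

(* Smoothness is tested along the local diffeomorphism circ : R -> S^1. *)
Definition is_smooth_action (side : action_side) {d : nat} {G : topGroupType}
    (A : set (chart R G d)) (act : G -> R * R -> R * R) : Prop :=
  [/\ forall h p, circle p -> circle (act h p),
      forall p, circle p -> act 1%g p = p,
      forall h k p, circle p ->
        act h (act k p) =
        act (match side with LeftAction => h * k | RightAction => k * h end)%g p
    & forall c, A c ->
        smooth (cdom c `*` [set: R])
          (fun us : 'rV[R]_d * R => act (param c us.1) (circ us.2))].

(* The coefficient of d/ds in the infinitesimal vector field of v at the point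
   circ s: the velocity at t = 0 of exp(tv).s is tangent to the circle, hence a
   multiple of circ'(s) = (- sin s, cos s), a unit vector. *)
Definition inf_field {G : Type} {n : nat} (expG : 'M[R]_n -> G)
    (act : G -> R * R -> R * R) (v : 'M[R]_n) (s : R) : R :=
  let w : R * R := derive1 (fun t : R => act (expG (t *: v)) (circ s)) 0 in
  - sin s * w.1 + cos s * w.2.

(* C^oo(S^1, g): functions on S^1 are 2pi-periodic functions of s. *)
Definition Csmooth {n : nat} (g : {vspace 'M[R]_n}) : set (R -> 'M[R]_n) :=
  [set x | [/\ smooth [set: R] x,
               forall s, x (s + 2 * pi) = x s &
               forall s, x s \in g]].

Section Brackets.
Context {n : nat}.
Implicit Types x y : R -> 'M[R]_n.

Definition pointwise_bracket x y : R -> 'M[R]_n := fun s => lie (x s) (y s).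

Section SecondBracket.
Context {G : Type} (side : action_side) (expG : 'M[R]_n -> G)
  (act : G -> R * R -> R * R) {r : nat} (v : r.-tuple 'M[R]_n).

(* The coefficient of d/ds in rho(x). *)
Definition rho x (s : R) : R :=
  \sum_(j < r) coord v j (x s) * inf_field expG act (v`_j) s.

Definition lie_deriv x y : R -> 'M[R]_n := fun s =>
  \sum_(j < r) (rho x s * derive1 (fun u : R => coord v j (y u)) s) *: v`_j.

Definition second_bracket x y : R -> 'M[R]_n :=
  match side with
  | LeftAction => lie_deriv x y - lie_deriv y x - pointwise_bracket x y
  | RightAction => - lie_deriv x y + lie_deriv y x - pointwise_bracket x y
  end.

End SecondBracket.

Definition beta x y : R :=
  \int[lebesgue_measure]_(s in `[0, 2 * pi]) \tr (x s *m derive1 y s).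

End Brackets.

End Circle.

(* b is a cocycle on the subspace C of V endowed with the bracket br. *)
Definition cocycle {R : realType} {V : lmodType R} (C : set V)
    (br : V -> V -> V) (b : V -> V -> R) : Prop :=
  [/\ forall x y, C x -> C y -> C (br x y),
      forall x y, C x -> C y -> b x y = - b y x,
      forall a x y z, C x -> C y -> C z -> b (a *: x + y) z = a * b x z + b y z,
      forall a x y z, C x -> C y -> C z -> b z (a *: x + y) = a * b z x + b z y
    & forall w1 w2 w3, C w1 -> C w2 -> C w3 ->
        b w1 (br w2 w3) + b w2 (br w3 w1) + b w3 (br w1 w2) = 0].

(* Main.v *)
(** Integration by parts makes beta skew.  In the cocycle sum written as the sum
    of the integrals of tr ([[x, y]] z_s) over cyclic permutations, the
    Lie-derivative terms tr ((rho(x) y_s - rho(y) x_s) z_s) cancel pointwise and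
    the commutator terms add up to d/ds tr (x [y, z]), whose integral over the
    circle vanishes.  The one analytic input is that [[x, y]] is again smooth:
    the field of v is the derivative of the smooth local expression
    (u, s) |-> act (param u) (circ s) in the direction (theta v, 0). *)

Require Import Defs.
From HB Require Import structures.
From mathcomp Require Import all_boot all_order all_algebra.
From mathcomp Require Import all_classical all_reals all_analysis.
From mathcomp Require Import ring.

Set Implicit Arguments.
Unset Strict Implicit.
Unset Printing Implicit Defensive.

Import Order.TTheory GRing.Theory Num.Theory.
Import numFieldNormedType.Exports.

Local Open Scope classical_set_scope.
Local Open Scope ring_scope.

(** * Calculus of $C^k$ maps between normed spaces *)

Section CkCalculus.
Context {R : realType}.
Implicit Types V W : normedModType R.

(** Expanding the argument on the matrix units makes [L] a finite sum of continuous coordinates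
    times fixed vectors. This serves the trace, the coordinates in a basis of [g] and the projection
    onto [g]. *)
Lemma linear_mx_continuous m n W (L : {linear 'M[R]_(m, n) -> W}) :
  continuous L.
Proof.
have -> : L = (fun M => \sum_i \sum_j M i j *: L (delta_mx i j)) :> (_ -> _).
  apply/funext => M; rewrite {1}(matrix_sum_delta M) linear_sum.
  apply: eq_bigr => i _; rewrite linear_sum.
  by apply: eq_bigr => j _; rewrite linearZZ.
move=> M; apply: (@cvg_big _ _ _ _ _ _ _ (nbhs M)) => [|i _].
  exact: add_continuous.
apply: (@cvg_big _ _ _ _ _ _ _ (nbhs M)) => [|j _]; first exact: add_continuous.
by apply: cvgZ; [exact: coord_continuous | exact: cvg_cst].
Qed.

(** By linearity [L] commutes with difference quotients, and by continuity with their limit. *)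
Lemma derivable_linear V W W' (L : {linear W -> W'}) (f : V -> W) x v :
  continuous L -> derivable f x v ->
  derivable (L \o f) x v /\ 'D_v (L \o f) x = L ('D_v f x).
Proof.
move=> cL df.
have E : (fun h => h^-1 *: ((L \o f \o shift x) (h *: v) - (L \o f) x)) =
    L \o (fun h => h^-1 *: ((f \o shift x) (h *: v) - f x)).
  by apply/funext => h /=; rewrite linearZZ (linearB L).
have lim : h^-1 *: ((L \o f \o shift x) (h *: v) - (L \o f) x) @[h --> 0^']
    --> L ('D_v f x).
  by rewrite E; apply: continuous_cvg; [exact: cL | exact: df].
by split; [exact: cvgP lim | exact: (cvg_lim _ lim)].
Qed.

Lemma CkS V W k (U : set V) (f : V -> W) : Ck k.+1 U f -> Ck k U f.
Proof.
elim: k f => [|k IH] f [df cf].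
  by move=> x Ux; apply: differentiable_continuous; exact: df.
by split=> // v; apply: IH; exact: cf.
Qed.

Lemma Ck_cst V W k (a : W) : Ck k [set: V] (fun=> a).
Proof.
elim: k a => [|k IH] a; first by move=> x _; exact: cvg_cst.
split=> [x _|v]; first exact: differentiable_cst.
have -> : (fun x => 'D_v (fun=> a) x) = (fun=> 0) :> (V -> W).
  by apply/funext => x; exact: derive_cst.
exact: IH.
Qed.

Lemma CkD V W k (f g : V -> W) :
  Ck k setT f -> Ck k setT g -> Ck k setT (f + g).
Proof.
elim: k f g => [|k IH] f g.
  by move=> cf cg x _; apply: cvgD; [exact: cf | exact: cg].
move=> [df cf] [dg cg]; split=> [x _|v].
  by apply: differentiableD; [exact: df | exact: dg].
have -> : (fun x => 'D_v (f + g) x) = (fun x => 'D_v f x) + (fun x => 'D_v g x).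
  by apply/funext => x; rewrite deriveD //; apply: diff_derivable;
    [exact: df | exact: dg].
by apply: IH; [exact: cf | exact: cg].
Qed.

Lemma Ck_sum V W k (I : Type) (s : seq I) (P : pred I) (f : I -> V -> W) :
  (forall i, P i -> Ck k setT (f i)) ->
  Ck k setT (fun x => \sum_(i <- s | P i) f i x).
Proof.
move=> cf.
have -> : (fun x => \sum_(i <- s | P i) f i x) = \sum_(i <- s | P i) f i.
  by apply/funext => x; rewrite fct_sumE.
by apply: big_ind => //; [exact: Ck_cst | move=> *; exact: CkD].
Qed.

Lemma Ck_linear V W W' k (L : {linear W -> W'}) (f : V -> W) :
  continuous L -> Ck k setT f -> Ck k setT (L \o f).
Proof.
move=> cL; elim: k f => [|k IH] f.
  by move=> cf x _; apply: continuous_comp; [exact: cf | exact: cL].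
move=> [df cf]; split=> [x _|v].
  apply: differentiable_comp; first exact: df.
  exact: linear_differentiable.
have -> : (fun x => 'D_v (L \o f) x) = L \o (fun x => 'D_v f x).
  apply/funext => x; apply: (derivable_linear cL _).2.
  by apply: diff_derivable; exact: df.
by apply: IH; exact: cf.
Qed.

Lemma CkM V k (f g : V -> R) : Ck k setT f -> Ck k setT g -> Ck k setT (f * g).
Proof.
elim: k f g => [|k IH] f g.
  by move=> cf cg x _; apply: cvgM; [exact: cf | exact: cg].
move=> Cf Cg; have [df cf] := Cf; have [dg cg] := Cg.
split=> [x _|v]; first by apply: differentiableM; [exact: df | exact: dg].
have -> : (fun x => 'D_v (f * g) x) =
    f * (fun x => 'D_v g x) + g * (fun x => 'D_v f x).
  by apply/funext => x; rewrite deriveM //; apply: diff_derivable;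
    [exact: df | exact: dg].
(* Each term of the product rule keeps one undifferentiated factor, whose regularity has to be
   lowered from [k.+1] to [k]. *)
apply: CkD; apply: IH; [exact: CkS Cf | exact: cg | exact: CkS Cg | exact: cf].
Qed.

Lemma Ck_entry V m n k (f : V -> 'M[R]_(m, n)) i j :
  Ck k setT f -> Ck k setT (fun x => f x i j).
Proof.
move=> Cf; have L : linear (fun M : 'M[R]_(m, n) => M i j : R^o).
  by move=> a A B; rewrite !mxE.
pose lm := GRing.isLinear.Build _ _ _ _ _ L.
pose e : {linear 'M[R]_(m, n) -> R^o} :=
  HB.pack (fun M : 'M[R]_(m, n) => M i j) lm.
exact: (Ck_linear (@coord_continuous _ _ _ i j : continuous e) Cf).
Qed.

(** The map is the sum of its entries times matrix units, and each summand is the image of a real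
    function under the continuous linear map that sends [t] to [t *: delta_mx i j]. *)
Lemma Ck_mx V m n k (f : V -> 'M[R]_(m, n)) :
  (forall i j, Ck k setT (fun x => f x i j)) -> Ck k setT f.
Proof.
move=> Cf.
have -> : f = (fun x => \sum_i \sum_j f x i j *: delta_mx i j).
  by apply/funext => x; exact: matrix_sum_delta.
apply: Ck_sum => i _; apply: Ck_sum => j _.
have cZ : continuous ( *:%R^~ (delta_mx i j : 'M[R]_(m, n)) : R^o -> _).
  by move=> t; apply: cvgZ; [exact: cvg_id | exact: cvg_cst].
have L : linear ( *:%R^~ (delta_mx i j : 'M[R]_(m, n)) : R^o -> _).
  by move=> a s t; rewrite scalerDl scalerA.
pose lm := GRing.isLinear.Build _ _ _ _ _ L.
pose e : {linear R^o -> 'M[R]_(m, n)} :=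
  HB.pack ( *:%R^~ (delta_mx i j : 'M[R]_(m, n)) : R^o -> _) lm.
exact: (Ck_linear (cZ : continuous e) (Cf i j)).
Qed.

Lemma Ck_scale V m n k (a : V -> R) (f : V -> 'M[R]_(m, n)) :
  Ck k setT a -> Ck k setT f -> Ck k setT (fun x => a x *: f x).
Proof.
move=> Ca Cf; apply: Ck_mx => i j.
have -> : (fun x => (a x *: f x) i j) = a * (fun x => f x i j).
  by apply/funext => x; rewrite mxE.
by apply: CkM => //; exact: Ck_entry.
Qed.

Lemma Ck_mulmx V m n p k (f : V -> 'M[R]_(m, n)) (g : V -> 'M[R]_(n, p)) :
  Ck k setT f -> Ck k setT g -> Ck k setT (fun x => f x *m g x).
Proof.
move=> Cf Cg; apply: Ck_mx => i j.
under eq_fun do rewrite mxE.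
by apply: Ck_sum => l _; apply: CkM; exact: Ck_entry.
Qed.

(** The derivative of a slice in direction [v] is the slice of the derivative of [f] in direction
    [(0, v)], so the induction on [k] stays among slices at [a]. *)
Lemma Ck_slice V V' W k (U : set V) (f : V * V' -> W) a :
  U a -> Ck k (U `*` setT) f -> Ck k setT (fun s => f (a, s)).
Proof.
move=> Ua; elim: k f => [|k IH] f.
  move=> cf s _; apply: (@continuous_comp _ _ _ (fun s => (a, s)) f).
    by apply: cvg_pair; [exact: cvg_cst | exact: cvg_id].
  exact: cf.
move=> [df cf]; split=> [s _|v].
  apply: (@differentiable_comp _ _ _ _ (fun s => (a, s)) f).
    by apply: differentiable_pair; [exact: differentiable_cst | exact: ex_diff].
  exact: df.
have -> : (fun s => 'D_v (fun s => f (a, s)) s) =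
    (fun s => 'D_(0, v) f (a, s)).
  apply/funext => s; rewrite /derive.
  suff -> : (fun h => h^-1 *: (((fun s => f (a, s)) \o shift s) (h *: v) -
      f (a, s))) =
    (fun h => h^-1 *: ((f \o shift (a, s)) (h *: (0, v)) - f (a, s))) by [].
  apply/funext => h /=.
  suff -> : h *: ((0 : V), v) + (a, s) = (a, h *: v + s) by [].
  by rewrite -[LHS]/(h *: 0 + a, h *: v + s) scaler0 add0r.
exact: (IH (fun x => 'D_(0, v) f x) (cf (0, v))).
Qed.

End CkCalculus.

(** * Smooth curves in normed spaces and derivatives of matrix-valued curves *)

Section SmoothCurves.
Context {R : realType}.
Implicit Types W : normedModType R.

Lemma smooth_derivable W (f : R -> W) x : smooth setT f -> derivable f x 1.
Proof. by move=> Cf; apply: diff_derivable; exact: (Cf 1%N).1. Qed.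

Lemma smooth_continuous W (f : R -> W) : smooth setT f -> continuous f.
Proof. by move=> Cf x; exact: (Cf 0%N). Qed.

Lemma smooth_derive1 W (f : R -> W) : smooth setT f -> smooth setT (derive1 f).
Proof.
move=> Cf k; have -> : (derive1 f) = (fun x => 'D_1 f x).
  by apply/funext => x; exact: derive1E.
exact: (Cf k.+1).2.
Qed.

(** [Ck] asks for derivatives in every direction of the line; this reduces them to the ordinary
    derivative. *)
Lemma derive_scale1 W (f : R -> W) x v :
  derivable f x 1 -> 'D_v f x = v *: 'D_1 f x.
Proof.
move=> /derivable1_diffP df; rewrite !deriveE // -[X in 'd f x X]mulr1.
by rewrite -[v * 1]/(v *: (1 : R^o)) linearZZ.
Qed.

(** Differentiation exchanges the two functions up to sign, hence a joint induction. *)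
Lemma Ck_sin_cos k : Ck k setT (@sin R) /\ Ck k setT (@cos R).
Proof.
elim: k => [|k [IHs IHc]].
  by split=> x _; [exact: continuous_sin | exact: continuous_cos].
split; split=> [x _|v].
- exact/derivable1_diffP/derivable_sin.
- have -> : (fun x => 'D_v sin x) = (fun=> v) * @cos R.
    apply/funext => x; rewrite derive_scale1; last exact: derivable_sin.
    by rewrite (@derive_val _ _ _ _ _ _ _ (is_derive_sin x)).
  by apply: CkM => //; exact: Ck_cst.
- exact/derivable1_diffP/derivable_cos.
have -> : (fun x => 'D_v cos x) = (fun=> - v) * @sin R.
  apply/funext => x; rewrite derive_scale1; last exact: derivable_cos.
  rewrite (@derive_val _ _ _ _ _ _ _ (is_derive_cos x)).
  by rewrite -[RHS]/(- v * sin x) mulNr -mulrN.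
by apply: CkM => //; exact: Ck_cst.
Qed.

Lemma is_derive_mxP m n (M : R -> 'M[R]_(m, n)) (t : R) (dM : 'M[R]_(m, n)) :
  is_derive t 1 M dM <->
  forall i j, is_derive t 1 (fun s => M s i j) (dM i j).
Proof.
split=> [[dM1 <-] i j|H].
  rewrite derive_mx // mxE; apply: derivableP.
  by move/derivable_mxP: dM1; exact.
have dM1 : derivable M t 1 by apply/derivable_mxP => i j; case: (H i j).
apply: DeriveDef => //; rewrite derive_mx //; apply/matrixP => i j.
by rewrite mxE; case: (H i j).
Qed.

Lemma is_derive_mulmx m n p (M : R -> 'M[R]_(m, n)) (N : R -> 'M[R]_(n, p))
    (t : R) dM dN :
  is_derive t 1 M dM -> is_derive t 1 N dN ->
  is_derive t 1 (fun s => M s *m N s) (dM *m N t + M t *m dN).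
Proof.
move=> /is_derive_mxP HM /is_derive_mxP HN; apply/is_derive_mxP => i j.
have -> : (fun s => (M s *m N s) i j) =
    \sum_(k < n) ((fun s => M s i k) * (fun s => N s k j)).
  by apply/funext => s; rewrite fct_sumE mxE.
have -> : (dM *m N t + M t *m dN) i j =
    \sum_(k < n) (M t i k *: dN k j + N t k j *: dM i k).
  rewrite !mxE -big_split /=; apply: eq_bigr => k _.
  by rewrite addrC; congr (_ + _); rewrite mulrC.
by apply: is_derive_sum => k; exact: is_deriveM.
Qed.

Lemma smooth_is_derive W (f : R -> W) (t : R) :
  smooth setT f -> is_derive t 1 f (derive1 f t).
Proof. by move=> Cf; rewrite derive1E; apply/derivableP/smooth_derivable. Qed.

Lemma is_derive1_eq W (f : R -> W) (t : R) df :
  is_derive t 1 f df -> derive1 f t = df.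
Proof. by move=> H; rewrite derive1E; exact: derive_val. Qed.

Lemma is_derive_mxtrace n (M : R -> 'M[R]_n) (t : R) dM :
  is_derive t 1 M dM -> is_derive t 1 (fun s => \tr (M s)) (\tr dM).
Proof.
move=> [dM1 <-].
have L : linear (@mxtrace R n : _ -> R^o) by move=> a A B; rewrite linearP.
pose lm := GRing.isLinear.Build _ _ _ _ _ L.
pose tr : {linear 'M[R]_n -> R^o} := HB.pack (@mxtrace R n : _ -> R^o) lm.
have [d e] := derivable_linear (@linear_mx_continuous _ _ _ _ tr) dM1.
exact: DeriveDef.
Qed.

End SmoothCurves.

(** * Smoothness and periodicity of the infinitesimal vector fields of the action *)

Section InfinitesimalField.
Context {R : realType} {n d : nat} (g : {vspace 'M[R]_n}) (G : topGroupType)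
  (A : set (chart R G d)) (c : chart R G d)
  (theta : {linear 'M[R]_n -> 'rV[R]_d}) (expG : 'M[R]_n -> G)
  (side : action_side) (act : G -> R * R -> R * R).
Hypotheses (hG : is_lie_group A) (hc : A c) (hc1 : dom c 1%g)
  (hLie : is_lie_algebra_of A c g theta expG)
  (hact : is_smooth_action side A act).

Let F (us : 'rV[R]_d * R) : R * R := act (param c us.1) (circ us.2).

(* Chain rule: for small [t] the curve [expG (t X)] stays in the chart [c],
   where its velocity at [0] is [theta X]. *)
Lemma action_velocity X s : X \in g ->
  derive1 (fun t : R => act (expG (t *: X)) (circ s)) 0 =
  'D_(theta X, 0) F (coo c 1%g, s).
Proof.
move=> Xg; have [_ _ /(_ X Xg) [hom [cts smo] vel]] := hLie.
have [_ [/(_ c hc) [odom _ cooK _ _] _ _] _ _] := hG.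
have [_ _ _ /(_ c hc) smF] := hact.
pose e (t : R) := expG (t *: X).
(* The one-parameter subgroup property at [0 + 0] makes [e 0] idempotent, and [1] is the only
   idempotent of a group. *)
have e0 : e 0 = 1%g.
  have := hom 0 0; rewrite addr0 -/(e 0) => E.
  by apply: (mulgI (e 0)); rewrite mulg1 -E.
have ndom : \forall t \near (0 : R), dom c (e t).
  apply: (cts 0 I (dom c)); apply: open_nbhs_nbhs; split => //.
  by rewrite -/(e 0) e0.
pose ga (t : R) := coo c (e t).
have dga : differentiable ga 0.
  by apply: (smo c hc 1%N).1; split => //=; rewrite -/(e 0) e0.
have ga0 : ga 0 = coo c 1%g by rewrite /ga e0.
pose ps (t : R) := (ga t, s).
have ds : differentiable (cst s : R -> R) 0 by exact: differentiable_cst.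
have dps : differentiable ps 0 by exact: differentiable_pair dga ds.
have dF : differentiable F (ps 0).
  by apply: (smF 1%N).1; split => //=; exists 1%g.
rewrite derive1E.
transitivity ('D_1 (F \o ps) 0).
  apply: near_eq_derive; near=> t.
  by rewrite /= /F /= /ga cooK //; near: t.
rewrite deriveE; last exact: differentiable_comp.
rewrite diff_comp // deriveE -?ga0 //=; congr ('d F _ _).
(* The point [s] is frozen along the curve [ps], so the second component of its velocity is [0]. *)
rewrite (_ : 'd ps 0 1 = ('d ga 0 1, 'd (cst s : R -> R) 0 1)); last first.
  by rewrite (diff_pair dga ds).
by rewrite diff_cst -deriveE // -derive1E vel.
Unshelve. all: by end_near. Qed.

(** By [action_velocity], the velocity as a function of [s] is a slice, at the coordinates of [1],
    of a directional derivative of [F]. Its regularity of order [k] comes from that of [F] at order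
    [k.+1]; taking components and combining them with [sin] and [cos] preserves it. *)
Lemma inf_field_smooth X : X \in g -> smooth setT (inf_field expG act X).
Proof.
move=> Xg k; rewrite /inf_field.
under eq_fun => s do rewrite action_velocity //.
have [_ _ _ /(_ c hc) smF] := hact.
have Cw : Ck k setT (fun s => 'D_(theta X, 0) F (coo c 1%g, s)).
  apply: (@Ck_slice _ _ _ _ _ (cdom c) ('D_(theta X, 0) F)).
    by exists 1%g.
  exact: (smF k.+1).2.
have [Cs Cc] := @Ck_sin_cos R k.
have c1 : continuous (fst : R^o * R^o -> R^o) by move=> x; exact: cvg_fst.
have c2 : continuous (snd : R^o * R^o -> R^o) by move=> x; exact: cvg_snd.
have C1 := Ck_linear c1 Cw.
have C2 := Ck_linear c2 Cw.
have Cns := CkM (@Ck_cst _ R R k (-1 : R)) Cs.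
under eq_fun => s do rewrite -(mulN1r (sin s)).
exact: (CkD (CkM Cns C1) (CkM Cc C2)).
Qed.

Lemma circ_periodic s : circ (s + 2 * pi) = circ s :> R * R.
Proof. by rewrite /circ mulr_natl cosD2pi sinD2pi. Qed.

Lemma inf_field_periodic X s :
  inf_field expG act X (s + 2 * pi) = inf_field expG act X s.
Proof. by rewrite /inf_field circ_periodic mulr_natl cosD2pi sinD2pi. Qed.

End InfinitesimalField.

(** * Integration over one period *)

Section CircleIntegral.
Context {R : realType}.
Local Notation mu := (@lebesgue_measure R).
Implicit Types f h : R -> R.

Lemma circle_integrable f : continuous f ->
  mu.-integrable `[0%R, (2 * pi)%R] (EFin \o f).
Proof.
move=> cf; apply: continuous_compact_integrable.
  exact: segment_compact.
exact: continuous_subspaceT.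
Qed.

(** Serves both as the linearity of [beta] and, with [a] equal to [1], as the additivity of the
    integral. *)
Lemma circle_integral_lin (a : R) f h : continuous f -> continuous h ->
  \int[mu]_(s in `[0%R, (2 * pi)%R]) (a * f s + h s) =
  a * \int[mu]_(s in `[0%R, (2 * pi)%R]) f s +
  \int[mu]_(s in `[0%R, (2 * pi)%R]) h s.
Proof.
move=> cf ch.
have caf : continuous (fun s => a * f s).
  by move=> s; apply: cvgM; [exact: cvg_cst | exact: cf].
rewrite RintegralD //; [|exact: circle_integrable..].
by rewrite RintegralZl //; exact: circle_integrable.
Qed.

(** By the fundamental theorem of calculus the integral is the difference of the endpoint values.
    This is the form of integration by parts behind both the skewness of [beta] and its cocycle
    identity. *)
Lemma circle_integral_derive (f df : R -> R) :
  (forall s : R, is_derive s 1 f (df s)) -> continuous df ->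
  f (2 * pi) = f 0 -> \int[mu]_(s in `[0%R, (2 * pi)%R]) df s = 0.
Proof.
move=> dfE cdf per.
have p0 : (0 : R) < 2 * pi by rewrite mulr_gt0 // pi_gt0.
have cf : continuous f.
  move=> s; apply: differentiable_continuous; apply/derivable1_diffP.
  by case: (dfE s).
rewrite /Rintegral (@continuous_FTC2 _ df f) ?per ?subee //.
- exact: continuous_subspaceT.
- split; first by move=> s _; case: (dfE s).
  + by apply: cvg_at_right_filter; exact: cf.
  + by apply: cvg_at_left_filter; exact: cf.
- by move=> s _; exact: is_derive1_eq.
Qed.

End CircleIntegral.

(** * Smooth loops in [g], trace identities, and the cocycle property of [beta] *)

Section CircleAlgebra.
Context {R : realType} {n : nat} (g : {vspace 'M[R]_n}).
Implicit Types x y z : R -> 'M[R]_n.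

Lemma periodic_derive1 x s T :
  (forall s, x (s + T) = x s) -> derive1 x (s + T) = derive1 x s.
Proof.
move=> per; rewrite /derive1.
suff -> : (fun h => h^-1 *: (x (h + (s + T)) - x (s + T))) =
  (fun h => h^-1 *: (x (h + s) - x s)) by [].
by apply/funext => h; rewrite addrA !per.
Qed.

(** The derivative stays in [g] because [x] is fixed by the linear projection onto [g], which
    commutes with differentiation. *)
Lemma Csmooth_derive1 x : Csmooth g x -> Csmooth g (derive1 x).
Proof.
move=> [Cx per xg]; split; first exact: smooth_derive1.
  by move=> s; exact: periodic_derive1.
move=> s.
pose P : {linear 'M[R]_n -> 'M[R]_n} := fun_of_lfun (projv g).
have [_] := derivable_linear (@linear_mx_continuous _ _ _ _ P)
  (@smooth_derivable _ _ _ s Cx).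
have -> : P \o x = x by apply/funext => t; rewrite /= projv_id.
by rewrite derive1E => ->; exact: memv_proj.
Qed.

Lemma Csmooth_scale (a : R -> R) x :
  smooth setT a -> (forall s, a (s + 2 * pi) = a s) ->
  Csmooth g x -> Csmooth g (fun s => a s *: x s).
Proof.
move=> Ca pa [Cx px gx]; split; last by move=> s; exact: memvZ.
  by move=> k; apply: Ck_scale; [exact: Ca | exact: Cx].
by move=> s; rewrite pa px.
Qed.

Lemma CsmoothZ (a : R) x : Csmooth g x -> Csmooth g (a *: x).
Proof. by apply: Csmooth_scale => // k; exact: Ck_cst. Qed.

Lemma CsmoothD x y : Csmooth g x -> Csmooth g y -> Csmooth g (x + y).
Proof.
move=> [Cx px gx] [Cy py gy]; split.
- by move=> k; apply: CkD; [exact: Cx | exact: Cy].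
- by move=> s; rewrite -[LHS]/(x _ + y _) px py.
- by move=> s; exact: memvD.
Qed.

Lemma CsmoothB x y : Csmooth g x -> Csmooth g y -> Csmooth g (x - y).
Proof. by move=> Cx Cy; rewrite -scaleN1r; apply/CsmoothD/CsmoothZ. Qed.

Lemma smooth_mulmx x y :
  smooth setT x -> smooth setT y -> smooth setT (fun s => x s *m y s).
Proof. by move=> Cx Cy k; apply: Ck_mulmx; [exact: Cx | exact: Cy]. Qed.

Lemma smooth_mxtrace x : smooth setT x -> smooth setT (fun s => \tr (x s)).
Proof. by move=> Cx k; apply: Ck_sum => i _; apply: Ck_entry; exact: Cx. Qed.

Lemma Csmooth_lie x y : lie_algebra g ->
  Csmooth g x -> Csmooth g y -> Csmooth g (pointwise_bracket x y).
Proof.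
move=> lg [Cx px gx] [Cy py gy]; split.
- move=> k; have C := CkD (smooth_mulmx Cx Cy k)
    (@Ck_scale _ _ _ _ _ _ _ (@Ck_cst _ R R k (-1 : R)) (smooth_mulmx Cy Cx k)).
  rewrite (_ : pointwise_bracket x y =
    (fun s => x s *m y s) + (fun s => -1 *: (y s *m x s))) //.
  by apply/funext => s; rewrite /GRing.add/= scaleN1r.
- by move=> s; rewrite /pointwise_bracket px py.
- by move=> s; exact: lg.
Qed.

Lemma is_derive_lie x y (s : R) dx dy :
  is_derive s 1 x dx -> is_derive s 1 y dy ->
  is_derive s 1 (pointwise_bracket x y) (lie dx (y s) + lie (x s) dy).
Proof.
move=> Dx Dy.
rewrite (_ : _ + _ = (dx *m y s + x s *m dy) - (dy *m x s + y s *m dx)).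
  exact: (is_deriveB (is_derive_mulmx Dx Dy) (is_derive_mulmx Dy Dx)).
by rewrite /lie [dy *m _ + _]addrC opprD !addrA; congr (_ + _); rewrite addrAC.
Qed.

(** Invariance of the trace form: both terms of the expanded commutator are traces of triple
    products, unchanged by cyclic rotation. *)
Lemma mxtrace_lie_cyc (a b c : 'M[R]_n) :
  \tr (a *m lie b c) = \tr (b *m lie c a).
Proof.
rewrite /lie !mulmxBr !raddfB /=; congr (_ - _).
  by rewrite mxtrace_mulC -mulmxA.
by rewrite mulmxA mxtrace_mulC mulmxA mxtrace_mulC mulmxA.
Qed.

Lemma mxtrace_first_order (e p q eps : R) (M N L w : 'M[R]_n) :
  \tr ((e *: (p *: M - q *: N) + eps *: L) *m w) =
  e * (p * \tr (M *m w) - q * \tr (N *m w)) + eps * \tr (w *m L).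
Proof.
rewrite mulmxDl -!scalemxAl mulmxBl -!scalemxAl mxtraceD !mxtraceZ.
by rewrite raddfB /= !mxtraceZ [\tr (L *m _)]mxtrace_mulC.
Qed.

(** Pointwise core of the cocycle identity: [p], [q], [r] stand for the coefficients of the vector
    fields of three loops with values [X], [Y], [Z] and derivatives [dX], [dY], [dZ]. Each of [p],
    [q], [r] multiplies the same symmetric trace twice with opposite signs; what remains is the
    Leibniz expansion of the derivative of $\mathrm{tr}(X[Y,Z])$, up to cyclic rotation. *)
Lemma mxtrace_first_order_cyc (e p q r eps : R) (X Y Z dX dY dZ : 'M[R]_n) :
  \tr ((e *: (q *: dZ - r *: dY) + eps *: lie Y Z) *m dX) +
  (\tr ((e *: (r *: dX - p *: dZ) + eps *: lie Z X) *m dY) +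
   \tr ((e *: (p *: dY - q *: dX) + eps *: lie X Y) *m dZ)) =
  eps * \tr (dX *m lie Y Z + X *m (lie dY Z + lie Y dZ)).
Proof.
rewrite !mxtrace_first_order (mulmxDr X (lie dY Z)) !mxtraceD.
rewrite (mxtrace_lie_cyc X dY) (mxtrace_lie_cyc X Y) (mxtrace_lie_cyc Y).
rewrite [\tr (dX *m dY)]mxtrace_mulC [\tr (dX *m dZ)]mxtrace_mulC.
by rewrite [\tr (dY *m dZ)]mxtrace_mulC; ring.
Qed.

Lemma beta_integrand_continuous x y : Csmooth g x -> Csmooth g y ->
  continuous (fun s => \tr (x s *m derive1 y s)).
Proof.
move=> [Cx _ _] [Cy _ _]; apply: smooth_continuous.
by apply/smooth_mxtrace/smooth_mulmx => //; exact: smooth_derive1.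
Qed.

Lemma beta_linearl a x y z : Csmooth g x -> Csmooth g y -> Csmooth g z ->
  beta (a *: x + y) z = a * beta x z + beta y z.
Proof.
move=> Cx Cy Cz; rewrite /beta -circle_integral_lin;
  [|exact: beta_integrand_continuous..].
apply: eq_Rintegral => s _.
by rewrite -[(a *: x + y) s]/(a *: x s + y s) mulmxDl -scalemxAl linearP.
Qed.

(** The sum of the two sides' integrands is the derivative of the periodic function
    $\mathrm{tr}(xy)$. *)
Lemma beta_skew x y : Csmooth g x -> Csmooth g y -> beta x y = - beta y x.
Proof.
move=> Cx Cy; apply/eqP; rewrite -addr_eq0 -[beta x y]mul1r /beta.
rewrite -circle_integral_lin; [|exact: beta_integrand_continuous..].
have [[sx px _] [sy py _]] := (Cx, Cy).
apply/eqP; apply: (@circle_integral_derive _ (fun s => \tr (x s *m y s))).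
- move=> s.
  rewrite mul1r [\tr (y s *m _)]mxtrace_mulC addrC -mxtraceD.
  by apply/is_derive_mxtrace/is_derive_mulmx; exact: smooth_is_derive.
- apply: (@smooth_continuous _ R) => k; apply: CkD; last first.
    by apply/smooth_mxtrace/smooth_mulmx => //; exact: smooth_derive1.
  apply: (CkM (f := fun=> 1)); first exact: Ck_cst.
  by apply/smooth_mxtrace/smooth_mulmx => //; exact: smooth_derive1.
- by rewrite -[2 * pi]add0r px py.
Qed.

Lemma beta_linearr a x y z : Csmooth g x -> Csmooth g y -> Csmooth g z ->
  beta z (a *: x + y) = a * beta z x + beta z y.
Proof.
move=> Cx Cy Cz; have Cxy := CsmoothD (CsmoothZ a Cx) Cy.
by rewrite !(@beta_skew z) // beta_linearl // opprD mulrN.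
Qed.

(* Both brackets have this form, with [e = 0] for the pointwise one. *)
Lemma cocycle_of_first_order_bracket (a : (R -> 'M[R]_n) -> R -> R) (e eps : R)
    (br : (R -> 'M[R]_n) -> (R -> 'M[R]_n) -> R -> 'M[R]_n) :
  lie_algebra g ->
  (forall x, Csmooth g x ->
    smooth setT (a x) /\ forall s, a x (s + 2 * pi) = a x s) ->
  (forall x y, Csmooth g x -> Csmooth g y ->
    br x y = e *: ((fun s => a x s *: derive1 y s) -
                   (fun s => a y s *: derive1 x s)) +
             eps *: pointwise_bracket x y) ->
  cocycle (Csmooth g) br (@beta R n).
Proof.
move=> lg sa brE.
have Cbr x y : Csmooth g x -> Csmooth g y -> Csmooth g (br x y).
  move=> Cx Cy; rewrite brE //; have [? ?] := sa x Cx; have [? ?] := sa y Cy.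
  apply: CsmoothD; apply: CsmoothZ; last exact: Csmooth_lie.
  by apply: CsmoothB; apply: Csmooth_scale => //; exact: Csmooth_derive1.
split=> //; [exact: beta_skew | exact: beta_linearl | exact: beta_linearr|].
move=> x y z Cx Cy Cz.
have [[Cyz Czx] Cxy] := (Cbr y z Cy Cz, Cbr z x Cz Cx, Cbr x y Cx Cy).
(* Skewness moves every bracket into the first argument, so that no derivative of a bracket, hence
   none of [a x], enters the integrands. *)
rewrite (beta_skew Cx Cyz) (beta_skew Cy Czx) (beta_skew Cz Cxy) -!opprD.
apply/eqP; rewrite oppr_eq0; apply/eqP.
have cyz := beta_integrand_continuous Cyz Cx.
have czx := beta_integrand_continuous Czx Cy.
have cxy := beta_integrand_continuous Cxy Cz.
(* The factors [1] give the sum of three integrands the shape required by two uses of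
   [circle_integral_lin]. *)
have c2 : continuous (fun s : R => 1 * \tr (br z x s *m derive1 y s) +
    \tr (br x y s *m derive1 z s)).
  move=> s; apply: cvgD; last exact: cxy.
  by apply: cvgM; [exact: cvg_cst | exact: czx].
suff K : \int[lebesgue_measure]_(s in `[0%R, (2 * pi)%R])
    (1 * \tr (br y z s *m derive1 x s) + (1 * \tr (br z x s *m derive1 y s) +
       \tr (br x y s *m derive1 z s))) = 0.
  have E1 := circle_integral_lin 1 cyz c2.
  have E2 := circle_integral_lin 1 czx cxy.
  rewrite -addrA -[RHS]K; symmetry; apply: etrans E1 _.
  by rewrite mul1r; congr (_ + _); apply: etrans E2 _; rewrite mul1r.
have [[[sx px _] [sy py _]] [sz pz _]] := (Cx, Cy, Cz).
(* The total integrand has the periodic primitive $\varepsilon\,\mathrm{tr}(x[y,z])$. *)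
apply: (@circle_integral_derive _
  (fun s => eps * \tr (x s *m pointwise_bracket y z s))).
- move=> s.
  have Dx := smooth_is_derive s sx; have Dy := smooth_is_derive s sy.
  have Dz := smooth_is_derive s sz.
  apply: is_derive_eq.
    exact: (is_deriveZ eps
      (is_derive_mxtrace (is_derive_mulmx Dx (is_derive_lie Dy Dz)))).
  rewrite !mul1r (brE y z) // (brE z x) // (brE x y) //; apply/esym.
  exact: mxtrace_first_order_cyc.
- move=> s; apply: cvgD; last exact: c2.
  by apply: cvgM; [exact: cvg_cst | exact: cyz].
- by rewrite -[2 * pi]add0r /pointwise_bracket px py pz.
Qed.
End CircleAlgebra.

Theorem proposition5p1 (R : realType) (n : nat) (g : {vspace 'M[R]_n})
    (hg : semisimple g)
    (d : nat) (G : topGroupType) (A : set (chart R G d))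
    (hG : is_lie_group A)
    (c : chart R G d) (hc : A c) (hc1 : dom c 1%g)
    (theta : {linear 'M[R]_n -> 'rV[R]_d}) (expG : 'M[R]_n -> G)
    (hLie : is_lie_algebra_of A c g theta expG)
    (side : action_side) (act : G -> R * R -> R * R)
    (hact : is_smooth_action side A act)
    (r : nat) (v : r.-tuple 'M[R]_n) (hv : basis_of g v) :
  cocycle (Csmooth g) (@pointwise_bracket R n) (@beta R n) /\
  cocycle (Csmooth g) (second_bracket side expG act v) (@beta R n).
Proof.
have lg : lie_algebra g by case: hg.
pose rh := rho expG act v.
(* Here [j] is any natural number; beyond the length of the tuple the default value [0] also lies in
   [g]. *)
have vg j : v`_j \in g by case: (ltnP j r) => jr;
  [rewrite (basis_mem hv) // mem_nth // size_tuple
  |rewrite nth_default ?size_tuple // mem0v].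
have coordE M : M \in g -> M = \sum_(j < r) coord v j M *: v`_j.
  by move=> Mg; exact: (coord_basis hv Mg).
(* Coordinates in the basis commute with differentiation, and [derive1 y] takes values in [g], so
   the coordinatewise Lie derivative reassembles into $\rho(x)\,y_s$. *)
have lie_derivE x y : Csmooth g y ->
    lie_deriv expG act v x y = (fun s => rh x s *: derive1 y s).
  move=> Cy; apply/funext => s; have [sy _ _] := Cy.
  have [_ _ dyg] := Csmooth_derive1 Cy.
  rewrite [in RHS](coordE _ (dyg s)) scaler_sumr; apply: eq_bigr => j _.
  rewrite scalerA; congr (_ * _ *: _).
  pose L : {linear 'M[R]_n -> R^o} := coord v j.
  have [_] := derivable_linear (@linear_mx_continuous _ _ _ _ L)
    (@smooth_derivable _ _ _ s sy).
  by rewrite !derive1E.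
have rho_smooth x : Csmooth g x ->
    smooth setT (rh x) /\ forall s, rh x (s + 2 * pi) = rh x s.
  move=> [Cx px _]; split=> [k|s].
    apply: Ck_sum => j _; apply: CkM.
      pose L : {linear 'M[R]_n -> R^o} := coord v j.
      exact: (Ck_linear (@linear_mx_continuous _ _ _ _ L) (Cx k)).
    exact: (inf_field_smooth hG hc hc1 hLie hact (vg j)).
  by apply: eq_bigr => j _; rewrite px inf_field_periodic.
split.
  (* The coefficient [0] removes the first-order part, so any smooth periodic choice of [a] would
     do. *)
  apply: (cocycle_of_first_order_bracket (a := rh) (e := 0) (eps := 1)) => //.
  by move=> x y _ _; rewrite scale0r add0r scale1r.
(* The side of the action changes only the sign of the first-order part; the commutator enters with
   sign [-1] in both cases. *)
apply: (cocycle_of_first_order_bracket (a := rh) (eps := -1)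
  (e := if side is LeftAction then 1 else -1)) => // x y Cx Cy.
rewrite /second_bracket !lie_derivE //.
case: (side); rewrite ?scale1r !scaleN1r //.
by congr (_ - _); rewrite opprB addrC.
Qed.
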